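(* For every set $U\subseteq V=\{X_1,\dots,X_n\}$ and every integer $k\ge1$, $$\gamma_{U,k}\;\ge\;\lambda_{\min}(C,k+|U|)\;\ge\;\lambda_{\min}(C).$$
   Context: Setting: $Z$ and $V=\{X_1,\dots,X_n\}$ are real random variables with mean $0$ and variance $1$. $C=(\mathrm{Cov}(X_i,X_j))_{i,j}$ is the covariance matrix of the $X_i$ and $\mathbf b=(\mathrm{Cov}(Z,X_i))_i$. For $S\subseteq V$ (identified with its index set), $C_S$ is the submatrix of $C$ with rows and columns in $S$ and $\mathbf b_S$ is the restriction of $\mathbf b$ to $S$. It is assumed throughout that $C$, and hence every $C_S$, is non-singular. The squared multiple correlation is $R^2_{Z,S}=1-\min_{\alpha}E[(Z-\sum_{i\in S}\alpha_iX_i)^2]=\mathbf b_S^{T}C_S^{-1}\mathbf b_S$ (and $R^2_{Z,\emptyset}=0$). Submodularity ratio: for $U\subseteq V$ and $k\ge1$, $$\gamma_{U,k}=\min_{L\subseteq U,\ S\subseteq V,\ |S|\le k,\ S\cap L=\emptyset}\frac{\sum_{i\in S}\bigl(R^2_{Z,L\cup\{X_i\}}-R^2_{Z,L}\bigr)}{R^2_{Z,S\cup L}-R^2_{Z,L}},$$ with the convention $0/0=1$. $\lambda_{\min}(C)$ is the smallest eigenvalue of $C$. Sparse eigenvalues: $\lambda_{\min}(C,m)=\min_{S:|S|=m}\lambda_{\min}(C_S)$ for $1\le m\le n$; for $m>n$ put $\lambda_{\min}(C,m)=\lambda_{\min}(C)$. *)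

(* Defs.v *)
From HB Require Import structures.
From mathcomp Require Import all_boot all_order all_algebra.
From mathcomp Require Import all_classical all_reals all_analysis.

Set Implicit Arguments.
Unset Strict Implicit.
Unset Printing Implicit Defensive.

Import Order.TTheory GRing.Theory Num.Theory.
Local Open Scope classical_set_scope.
Local Open Scope ring_scope.

(* The least element of A; the default value 0 is used only when A has no
   least element. *)
Definition minimum (R : realType) (A : set R) : R :=
  xget 0 [set x | A x /\ lbound A x].

Lemma minimumE (R : realType) (A : set R) (x : R) :
  A x -> lbound A x -> minimum A = x.
Proof.
move=> Ax lbx; apply: xget_unique => // y [Ay lby].
by apply/eqP; rewrite eq_le lby//= lbx.
Qed.

Section Spectral.
Variable R : realType.

Definition lambda_min (n : nat) (A : 'M[R]_n) : R :=
  minimum [set a | eigenvalue A a].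

Definition principal_submx (n : nat) (A : 'M[R]_n) (S : {set 'I_n}) :
    'M[R]_#|S| :=
  mxsub enum_val enum_val A.

Definition sparse_lambda_min (n : nat) (A : 'M[R]_n) (m : nat) : R :=
  if (m <= n)%N then
    minimum [set lambda_min (principal_submx A S) | S in
             [set S : {set 'I_n} | #|S| = m]]
  else lambda_min A.

End Spectral.

Section Regression.
Context {d : measure_display} {T : measurableType d} {R : realType}.
Variables (P : probability T R) (n : nat).

Definition cov_mx (X : 'I_n -> {RV P >-> R}) : 'M[R]_n :=
  \matrix_(i < n, j < n) fine (covariance P (X i) (X j)).

Definition mean_sq_error (Z : {RV P >-> R}) (X : 'I_n -> {RV P >-> R})
    (S : {set 'I_n}) (a : 'I_n -> R) : R :=
  fine 'E_P[fun w => (Z w - \sum_(i in S) a i * X i w) ^+ 2].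

(* Coefficients are indexed by all of 'I_n; those outside S are ignored. *)
Definition R2 (Z : {RV P >-> R}) (X : 'I_n -> {RV P >-> R})
    (S : {set 'I_n}) : R :=
  1 - minimum [set mean_sq_error Z X S a | a in [set: 'I_n -> R]].

(* Division with the convention 0 / 0 = 1. *)
Definition ratio01 (x y : R) : R :=
  if (x == 0) && (y == 0) then 1 else x / y.

Definition submod_ratio (Z : {RV P >-> R}) (X : 'I_n -> {RV P >-> R})
    (U : {set 'I_n}) (k : nat) : R :=
  minimum [set r | exists L S : {set 'I_n},
    [/\ L \subset U, (#|S| <= k)%N, [disjoint S & L]%B &
      r = ratio01 (\sum_(i in S) (R2 Z X (i |: L)%SET - R2 Z X L))
                  (R2 Z X (S :|: L)%SET - R2 Z X L)]].

End Regression.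

(* Main.v *)
(* The residual error of the predictor u is the quadratic
   err(u) = 1 - 2 u.b + u C u^T, and 1 - R^2_S is its minimum over the vectors
   supported on S. Let u be optimal for L and r = b - u C its residual, which
   vanishes on L by the normal equations. Moving u by r_i along coordinate i
   lowers err by exactly r_i^2, because C_ii = 1; hence the numerator of the
   ratio is at least sum_(i in S) r_i^2. Moving u by any w supported on S and L
   lowers err by 2 w.r - w C w^T <= 2 w.r - lam |w|^2
   <= (sum_(i in S) r_i^2) / lam, where lam is the sparse eigenvalue and C is
   bounded below by lam on such w; this bounds the denominator. *)
Require Import Defs.
From HB Require Import structures.
From mathcomp Require Import all_boot all_order all_algebra.
From mathcomp Require Import all_classical all_reals all_analysis.
From mathcomp Require Import measurable_realfun ring lra.

Set Implicit Arguments.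
Unset Strict Implicit.
Unset Printing Implicit Defensive.

Import Order.TTheory GRing.Theory Num.Theory.
Local Open Scope ring_scope.

(** * Quadratic forms on row vectors and the least eigenvalue of a symmetric matrix *)

Section QuadraticForms.
Variable R : realType.

Definition dotr n (u v : 'rV[R]_n) : R := \sum_i u 0 i * v 0 i.
Definition qform n (A : 'M[R]_n) (u : 'rV[R]_n) : R := dotr (u *m A) u.

Lemma dotrE n (u v : 'rV[R]_n) : dotr u v = (u *m v^T) 0 0.
Proof. by rewrite mxE; apply: eq_bigr => i _; rewrite mxE. Qed.

Lemma dotrC n (u v : 'rV[R]_n) : dotr u v = dotr v u.
Proof. by apply: eq_bigr => i _; rewrite mulrC. Qed.

Lemma dotr0 n (u : 'rV[R]_n) : dotr u 0 = 0.
Proof. by rewrite dotrE trmx0 mulmx0 mxE. Qed.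

(** Finiteness of [I] makes the minimum attained, so the default value of [minimum] cannot
    intervene. This serves both the sparse eigenvalues and the submodularity ratio. *)
Lemma minimum_image (I : finType) (A : set I) (f : I -> R) :
  (A !=set0)%classic ->
  exists2 i, A i & minimum [set f i | i in A]%classic = f i /\
                   forall j, A j -> f i <= f j.
Proof.
case=> i0 Ai0; have Pi0 : `[< A i0 >] by exact/asboolP.
case: (@arg_minP _ _ _ i0 (fun i => `[< A i >]) f Pi0) => i /asboolP Ai fi.
have {}fi j : A j -> f i <= f j by move=> Aj; apply: fi; exact/asboolP.
exists i => //; split => //.
by apply: minimumE => [|_ [j Aj <-]]; [exists i|exact: fi].
Qed.

Section Dot.
Variable n : nat.
Implicit Types (u v w : 'rV[R]_n) (A : 'M[R]_n) (a : R).

Lemma dotrDl u v w : dotr (u + v) w = dotr u w + dotr v w.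
Proof. by rewrite !dotrE mulmxDl mxE. Qed.

Lemma dotrZl a u w : dotr (a *: u) w = a * dotr u w.
Proof. by rewrite !dotrE -scalemxAl mxE. Qed.

Lemma dotrDr u v w : dotr w (u + v) = dotr w u + dotr w v.
Proof. by rewrite dotrC dotrDl !(dotrC w). Qed.

Lemma dotrZr a u w : dotr w (a *: u) = a * dotr w u.
Proof. by rewrite dotrC dotrZl dotrC. Qed.

Lemma dotrBr u v w : dotr w (u - v) = dotr w u - dotr w v.
Proof. by rewrite dotrDr -scaleN1r dotrZr mulN1r. Qed.

Lemma dotr_mulmx m (u : 'rV[R]_m) (B : 'M[R]_(m, n)) w :
  dotr (u *m B) w = dotr u (w *m B^T).
Proof. by rewrite !dotrE trmx_mul trmxK mulmxA. Qed.

Lemma dotr_sym A u v : A^T = A -> dotr (u *m A) v = dotr (v *m A) u.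
Proof. by move=> sA; rewrite dotr_mulmx sA dotrC. Qed.

Lemma dotr_ge0 u : 0 <= dotr u u.
Proof. by apply: sumr_ge0 => i _; rewrite -expr2 sqr_ge0. Qed.

Lemma dotr_eq0 u : (dotr u u == 0) = (u == 0).
Proof.
apply/idP/eqP => [|->]; last by rewrite /dotr big1// => i _; rewrite mxE mul0r.
rewrite psumr_eq0 => [/allP u0|i _]; last by rewrite -expr2 sqr_ge0.
apply/rowP => i; rewrite mxE; apply/eqP.
by have := u0 i (mem_index_enum i); rewrite mulf_eq0 orbb.
Qed.

Lemma dotr_gt0 u : (0 < dotr u u) = (u != 0).
Proof. by rewrite lt_def dotr_ge0 andbT dotr_eq0. Qed.

Lemma qformD A u v : A^T = A ->
  qform A (u + v) = qform A u + 2 * dotr (u *m A) v + qform A v.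
Proof.
by move=> sA; rewrite /qform mulmxDl !dotrDl !dotrDr (dotr_sym v u sA); ring.
Qed.

Lemma qformZ A a u : qform A (a *: u) = a ^+ 2 * qform A u.
Proof. by rewrite /qform -scalemxAl dotrZl dotrZr mulrA expr2. Qed.

Lemma qform_subscalar A a u : qform (A - a%:M) u = qform A u - a * dotr u u.
Proof.
by rewrite /qform mulmxBr mul_mx_scalar dotrDl -scaleN1r !dotrZl mulN1r.
Qed.

Lemma qform_delta A i : qform A (delta_mx 0 i) = A i i.
Proof.
rewrite /qform -rowE /dotr (bigD1 i)//= big1 => [|j ji]; rewrite !mxE !eqxx.
  by rewrite mulr1 addr0.
by rewrite (negbTE ji) mulr0.
Qed.

Lemma dotr_delta u i : dotr u (delta_mx 0 i) = u 0 i.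
Proof.
rewrite /dotr (bigD1 i)//= big1 => [|j ji]; rewrite !mxE !eqxx ?mulr1 ?addr0//.
by rewrite (negbTE ji) mulr0.
Qed.

(** Each term is at most [|A j i|] times |u|^2, by 2|u_i u_j| <= u_i^2 + u_j^2. The summand 1 keeps
    the constant positive even for [A = 0]. *)
Lemma qform_le_norm A : exists2 K, 0 < K & forall u, qform A u <= K * dotr u u.
Proof.
exists (1 + \sum_i \sum_j `|A j i|) => [|u].
  by apply: ltr_wpDr => //; apply: sumr_ge0 => i _; apply: sumr_ge0.
rewrite mulrDl mul1r; apply: ler_wpDl; first exact: dotr_ge0.
rewrite /qform {1}/dotr mulr_suml; apply: ler_sum => i _.
rewrite mxE !mulr_suml; apply: ler_sum => j _.
rewrite mulrAC mulrC.
have uu k : u 0 k ^+ 2 <= dotr u u.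
  rewrite /dotr (bigD1 k)//= -expr2 ler_wpDr//.
  by apply: sumr_ge0 => l _; rewrite -expr2 sqr_ge0.
apply: (le_trans (ler_norm _)); rewrite normrM ler_wpM2l//.
have [h1 h2] := (uu i, uu j).
have h : `|u 0 j * u 0 i| <= (u 0 j ^+ 2 + u 0 i ^+ 2) / 2.
  rewrite ler_norml.
  have := sqr_ge0 (u 0 j - u 0 i); have := sqr_ge0 (u 0 j + u 0 i).
  by rewrite !expr2 => *; apply/andP; split; nra.
lra.
Qed.

(** The form is nonnegative at every combination a u + b v; for p > 0 the choice a = p, b = -B gives
    p (q p - B^2) >= 0. *)
Lemma psd_cauchy_schwarz A u v : A^T = A -> (forall w, 0 <= qform A w) ->
  dotr (u *m A) v ^+ 2 <= qform A u * qform A v.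
Proof.
move=> sA A_ge0; set B := dotr _ _; set q := qform A u; set p := qform A v.
have sq a b : 0 <= a ^+ 2 * q + 2 * a * b * B + b ^+ 2 * p.
  have := A_ge0 (a *: u + b *: v).
  by rewrite qformD// !qformZ -scalemxAl dotrZl dotrZr -/B -/q -/p; lra.
have [p0|p0] := eqVneq p 0.
  rewrite p0 mulr0; have [->|B0] := eqVneq B 0; first by rewrite expr0n.
  (* With p = 0 the form at u + b v is q + 2 b B; this b would make it -1. *)
  have := sq 1 (- (q + 1) / (2 * B)); rewrite p0.
  have -> : 2 * 1 * (- (q + 1) / (2 * B)) * B = - (q + 1) by field.
  by rewrite mulr0 addr0 expr1n; lra.
have pgt0 : 0 < p by rewrite lt_def p0 /p A_ge0.
have := sq p (- B).
have -> : p ^+ 2 * q + 2 * p * - B * B + (- B) ^+ 2 * p = p * (q * p - B ^+ 2).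
  by ring.
by rewrite pmulr_rge0// subr_ge0.
Qed.

(* With w = u A^-1, Cauchy-Schwarz for the form A bounds |u|^4 = <wA, u>^2 by
   (w A w^T)(u A u^T), and w A w^T = u A^-1 u^T is O(|u|^2). *)
Lemma psd_unit_coercive A : A^T = A -> (forall w, 0 <= qform A w) ->
  A \in unitmx -> exists2 e, 0 < e & forall u, e * dotr u u <= qform A u.
Proof.
move=> sA A_ge0 uA; have [K K0 Kle] := qform_le_norm (invmx A).
exists K^-1 => [|u]; first by rewrite invr_gt0.
have [->|u0] := eqVneq u 0.
  by rewrite dotr0 mulr0.
have dgt0 : 0 < dotr u u by rewrite dotr_gt0.
have := psd_cauchy_schwarz (u *m invmx A) u sA A_ge0.
have -> : qform A (u *m invmx A) = qform (invmx A) u.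
  by rewrite /qform mulmxKV// dotrC.
rewrite mulmxKV// => /le_trans/(_ (ler_wpM2r (A_ge0 u) (Kle u))).
by rewrite expr2 mulrAC ler_pM2r// -ler_pdivrMl.
Qed.

Lemma eigenvalue_qform A a : eigenvalue A a ->
  exists2 v, v != 0 & qform A v = a * dotr v v.
Proof.
by case/eigenvalueP => v vA v0; exists v => //; rewrite /qform vA dotrZl.
Qed.

(* The least eigenvalue is the largest c for which A - c I is positive
   semidefinite: if A - c I were moreover invertible, coercivity would allow a
   larger c. *)
Lemma least_eigenvalue A : (0 < n)%N -> A^T = A ->
  exists2 c, eigenvalue A c & forall u, c * dotr u u <= qform A u.
Proof.
move=> n0 sA; pose E := [set c | forall u, c * dotr u u <= qform A u]%classic.
have [K K0 Kle] := qform_le_norm (- A).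
have E_nonempty : (E !=set0)%classic.
  exists (- K) => u; have := Kle u.
  by rewrite /qform mulmxN -scaleN1r dotrZl; lra.
have dd i : dotr (delta_mx 0 i) (delta_mx 0 i : 'rV[R]_n) = 1.
  by rewrite dotr_delta mxE !eqxx.
have E_ub : has_ubound E.
  exists (A (Ordinal n0) (Ordinal n0)) => c /(_ (delta_mx 0 (Ordinal n0))).
  by rewrite qform_delta dd mulr1.
have Esup : E (sup E).
  move=> u; have [->|u0] := eqVneq u 0.
    by rewrite /qform mul0mx dotr0 mulr0.
  have dgt0 : 0 < dotr u u by rewrite dotr_gt0.
  rewrite -ler_pdivlMr//; apply: ge_sup => // c Ec.
  by rewrite ler_pdivlMr//; exact: Ec.
exists (sup E) => //; rewrite /eigenvalue /eigenspace kermx_eq0 row_free_unit.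
apply/negP => Bunit.
have sB : (A - (sup E)%:M)^T = A - (sup E)%:M.
  by rewrite linearB /= tr_scalar_mx sA.
have [|e e0 ele] := psd_unit_coercive sB _ Bunit.
  by move=> w; rewrite qform_subscalar subr_ge0; exact: Esup.
suff : sup E + e <= sup E by rewrite gerDl leNgt e0.
apply: ub_le_sup => // u; have := ele u.
by rewrite qform_subscalar; lra.
Qed.

(** Testing the lower bound c of [least_eigenvalue] on an eigenvector for a gives c <= a, so c is
    the minimum in [lambda_min]. *)
Lemma lambda_minP A : (0 < n)%N -> A^T = A ->
  eigenvalue A (lambda_min A) /\
  forall u, lambda_min A * dotr u u <= qform A u.
Proof.
move=> n0 sA; have [c Ac cle] := least_eigenvalue n0 sA.
suff -> : lambda_min A = c by [].
apply: minimumE => // a /eigenvalue_qform[v v0 va].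
by have := cle v; rewrite va ler_pM2r// dotr_gt0.
Qed.

End Dot.

(** * Principal submatrices and sparse eigenvalues *)

Section Principal.
Variables (n : nat) (A : 'M[R]_n).
Implicit Types (S L : {set 'I_n}) (u v : 'rV[R]_n).

(** Vectors on [S] are kept at full length, so that different sets share one ambient space. *)
Definition supported S u := forall i, i \notin S -> u 0 i = 0.

Lemma supported_sub S L u : S \subset L -> supported S u -> supported L u.
Proof.
move=> /fintype.subsetP SL Su i iL; apply: Su.
by apply: contra iL; exact: SL.
Qed.

(** The rows are the basis vectors e_i for i in [S]: right multiplication extends a vector by zero,
    and right multiplication by the transpose restricts it to [S]. *)
Definition coord_incl S : 'M[R]_(#|S|, n) := rowsub enum_val 1%:M.

Lemma principal_submxE S :
  principal_submx A S = coord_incl S *m A *m (coord_incl S)^T.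
Proof.
rewrite /coord_incl mul_rowsub_mx mul1mx trmx_mxsub tr_scalar_mx mulmx_colsub.
by rewrite mulmx1; apply/matrixP => i j; rewrite !mxE.
Qed.

Lemma mulmx_coord_inclT m (B : 'M[R]_(m, n)) S :
  B *m (coord_incl S)^T = colsub enum_val B.
Proof. by rewrite trmx_mxsub tr_scalar_mx mulmx_colsub mulmx1. Qed.

Lemma coord_inclK S : coord_incl S *m (coord_incl S)^T = 1%:M.
Proof.
rewrite mulmx_coord_inclT; apply/matrixP => i j.
by rewrite !mxE (inj_eq enum_val_inj).
Qed.

Lemma supported_coord_incl S (w : 'rV[R]_#|S|) :
  supported S (w *m coord_incl S).
Proof.
move=> i iS; rewrite mxE big1// => j _; rewrite !mxE.
case: eqP => [ji|]; last by rewrite mulr0.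
by move: (enum_valP j); rewrite ji (negbTE iS).
Qed.

Lemma supportedE S u : supported S u ->
  u = u *m (coord_incl S)^T *m coord_incl S.
Proof.
move=> Su; rewrite mulmx_coord_inclT; apply/rowP => i.
have [iS|iS] := boolP (i \in S); last first.
  by rewrite Su//; symmetry; exact: supported_coord_incl.
rewrite mxE (bigD1 (enum_rank_in iS i))//= big1 => [|j ji].
  by rewrite !mxE enum_rankK_in// eqxx mulr1 addr0.
rewrite !mxE; case: eqP => [ji'|]; last by rewrite mulr0.
by case/eqP: ji; apply: enum_val_inj; rewrite enum_rankK_in.
Qed.

Lemma dotr_coord_incl S (w z : 'rV[R]_#|S|) :
  dotr (w *m coord_incl S) (z *m coord_incl S) = dotr w z.
Proof. by rewrite dotr_mulmx -mulmxA coord_inclK mulmx1. Qed.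

Lemma qform_principal_submx S (w : 'rV[R]_#|S|) :
  qform (principal_submx A S) w = qform A (w *m coord_incl S).
Proof. by rewrite /qform principal_submxE !mulmxA dotr_mulmx trmxK. Qed.

Hypothesis sA : A^T = A.

Lemma tr_principal_submx S : (principal_submx A S)^T = principal_submx A S.
Proof. by rewrite principal_submxE !trmx_mul trmxK sA mulmxA. Qed.

(** A kernel vector of the submatrix, extended by zero, has form value 0 and hence vanishes by
    definiteness. *)
Lemma principal_submx_unit S : (forall u, u != 0 -> 0 < qform A u) ->
  principal_submx A S \in unitmx.
Proof.
move=> A_gt0; rewrite -row_free_unit -kermx_eq0; apply/rowV0P => w.
move=> /sub_kermxP w0; apply/eqP; rewrite -dotr_eq0 -dotr_coord_incl dotr_eq0.
apply/negPn/negP => /A_gt0; rewrite -qform_principal_submx /qform w0.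
by rewrite /dotr big1 ?ltxx// => i _; rewrite mxE mul0r.
Qed.

Lemma lambda_min_principal_submx S u : (0 < #|S|)%N -> supported S u ->
  lambda_min (principal_submx A S) * dotr u u <= qform A u.
Proof.
move=> S0 Su; have [_ le_q] := lambda_minP S0 (tr_principal_submx S).
rewrite (supportedE Su) dotr_coord_incl -qform_principal_submx; exact: le_q.
Qed.

Lemma sparse_lambda_min_le m S u : (0 < m)%N -> (#|S| <= m)%N ->
  supported S u -> sparse_lambda_min A m * dotr u u <= qform A u.
Proof.
move=> m0 Sm Su; rewrite /sparse_lambda_min; case: ifPn => [mn|]; last first.
  rewrite -ltnNge => nm.
  (* For n = 0 both sides are empty sums. *)
  case: (posnP n) => [n0|n0]; last by have [_] := lambda_minP n0 sA; exact.
  rewrite /qform /dotr !big1 ?mulr0// => i; exfalso;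
    by have := leq_ltn_trans (leq0n i) (ltn_ord i); rewrite n0.
(* The sparse eigenvalue ranges over sets of exactly m elements, so [S] is padded with m - |S|
   indices from its complement. *)
have [M SM cM] : exists2 M : {set 'I_n}, S \subset M & #|M| = m.
  have : (m - #|S| <= #|~: S|)%N.
    by rewrite [leqRHS]cardsCs finset.setCK card_ord leq_sub2r.
  case/card_geqP => s [us ss sS]; exists (S :|: [set:: s]).
    exact: finset.subsetUl.
  rewrite cardsU (_ : S :&: [set:: s] = finset.set0)%SET.
    by rewrite cards0 subn0 cardsE (card_uniqP us) ss subnKC.
  apply/setP => i; rewrite !inE; apply/negP => /andP[iS /sS].
  by rewrite inE iS.
have [M' cM' [-> le_min]] := minimum_image
  (fun M' => lambda_min (principal_submx A M'))
  (ex_intro [set M' : {set 'I_n} | #|M'| = m]%classic M cM).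
apply: le_trans (lambda_min_principal_submx _ (supported_sub SM Su)).
  by rewrite ler_wpM2r ?dotr_ge0// le_min.
by rewrite cM.
Qed.

(** An eigenvector of the minimising submatrix, extended by zero, is a test vector for [A]. *)
Lemma lambda_min_le_sparse m : (0 < m)%N ->
  lambda_min A <= sparse_lambda_min A m.
Proof.
move=> m0; rewrite /sparse_lambda_min; case: ifPn => // mn.
have [M cM] : ([set M : {set 'I_n} | #|M| = m] !=set0)%classic.
  have : (m <= #|[set: 'I_n]|)%N by rewrite cardsT card_ord.
  case/card_geqP => s [us ss _]; exists [set:: s]%SET => /=.
  by rewrite cardsE (card_uniqP us).
have [M' cM' [-> _]] := minimum_image
  (fun M' => lambda_min (principal_submx A M'))
  (ex_intro [set M' : {set 'I_n} | #|M'| = m]%classic M cM).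
have M'0 : (0 < #|M'|)%N by rewrite cM'.
have [ev _] := lambda_minP M'0 (tr_principal_submx M').
have [v v0 va] := eigenvalue_qform ev.
have [_ le_q] := lambda_minP (leq_trans m0 mn) sA.
have := le_q (v *m coord_incl M').
by rewrite dotr_coord_incl -qform_principal_submx va ler_pM2r// dotr_gt0.
Qed.

End Principal.

(** * Least squares over vectors of given support *)

Section LeastSquares.
Variables (n : nat) (C : 'M[R]_n) (b : 'rV[R]_n).
Implicit Types (S L : {set 'I_n}) (u v : 'rV[R]_n).

Definition quad_err u : R := 1 - 2 * dotr u b + qform C u.

Hypothesis sC : C^T = C.

(** The residual b - u C is minus half the gradient of the error at u, so this is the exact
    second-order expansion. *)
Lemma quad_errD u v :
  quad_err (u + v) = quad_err u - 2 * dotr v (b - u *m C) + qform C v.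
Proof.
rewrite /quad_err qformD// dotrDl dotrBr (dotrC v (u *m C)).
by ring.
Qed.

Hypothesis C_gt0 : forall u, u != 0 -> 0 < qform C u.

Lemma normal_equations S : exists2 u, supported S u &
  forall i, i \in S -> (b - u *m C) 0 i = 0.
Proof.
have CSu := principal_submx_unit S C_gt0.
pose w := b *m (coord_incl S)^T *m invmx (principal_submx C S).
exists (w *m coord_incl S) => [|i iS]; first exact: supported_coord_incl.
have : (b - w *m coord_incl S *m C) *m (coord_incl S)^T = 0.
  rewrite mulmxBl /w -!mulmxA (mulmxA (coord_incl S) C) -principal_submxE.
  by rewrite mulVmx// mulmx1 subrr.
rewrite mulmx_coord_inclT => /rowP/(_ (enum_rank_in iS i)).
by rewrite mxE enum_rankK_in// [in RHS]mxE.
Qed.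

Lemma qform_ge0 u : 0 <= qform C u.
Proof.
have [->|/C_gt0/ltW//] := eqVneq u 0.
by rewrite /qform dotr0.
Qed.

(** The linear term in v - u vanishes, since v - u lives on [S] and the residual is zero there; the
    quadratic term is nonnegative. *)
Lemma quad_err_min S u v : supported S u ->
  (forall i, i \in S -> (b - u *m C) 0 i = 0) ->
  supported S v -> quad_err u <= quad_err v.
Proof.
move=> Su ru Sv; rewrite -[v](subrK u) [_ + u]addrC quad_errD.
have -> : dotr (v - u) (b - u *m C) = 0.
  rewrite /dotr big1// => i _; have [iS|iS] := boolP (i \in S).
    by rewrite ru// mulr0.
  by rewrite mxE [X in _ + X]mxE Su// Sv// subrr mul0r.
by rewrite mulr0 subr0 lerDl qform_ge0.
Qed.

Hypothesis C_diag : forall i, C i i = 1.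

(** A step t along e_i changes the error by t^2 - 2 t r_i because C_ii = 1; the best step is t =
    r_i. *)
Lemma quad_err_coord u i :
  quad_err (u + (b - u *m C) 0 i *: delta_mx 0 i) =
  quad_err u - (b - u *m C) 0 i ^+ 2.
Proof.
rewrite quad_errD dotrZl qformZ qform_delta C_diag dotrC dotr_delta; ring.
Qed.

(* Completing the square coordinatewise in the residual r = b - u C gives
   2 v.r - lam |v|^2 <= sum_i r_i^2 / lam. *)
Lemma quad_err_gain_le S L u v lam : 0 <= lam -> supported L u ->
  (forall i, i \in L -> (b - u *m C) 0 i = 0) ->
  supported (S :|: L) v ->
  (forall w, supported (S :|: L) w -> lam * dotr w w <= qform C w) ->
  lam * (quad_err u - quad_err v) <= \sum_(i in S) (b - u *m C) 0 i ^+ 2.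
Proof.
move=> lam0 Lu ru SLv SLq; set r := b - u *m C in ru *.
have SLvu : supported (S :|: L) (v - u).
  move=> i iSL; rewrite mxE [X in _ + X]mxE SLv// Lu ?subrr//.
  by apply: contra iSL; rewrite inE => ->; rewrite orbT.
have := SLq _ SLvu.
have -> : quad_err v = quad_err (u + (v - u)) by rewrite addrC subrK.
rewrite quad_errD -/r.
move: (v - u) SLvu => w SLw lam_le.
apply: (@le_trans _ _ (2 * lam * dotr w r - lam ^+ 2 * dotr w w)).
  have := ler_wpM2l lam0 lam_le; lra.
rewrite /dotr !mulr_sumr -sumrB [leRHS]big_mkcond; apply: ler_sum => i _.
case: ifPn => iS; first by have := sqr_ge0 (lam * w 0 i - r 0 i); lra.
(* Off [S], either the residual (on [L]) or w (off [L]) vanishes, so the term is at most 0. *)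
have [iL|iL] := boolP (i \in L); last by rewrite SLw ?inE ?negb_or ?iS//; lra.
by rewrite ru//; have := sqr_ge0 (lam * w 0 i); lra.
Qed.

(** An abstract R^2 keeps this part free of probability; [R2_attained] and [R2_ge] supply the two
    hypotheses for [R2]. *)
Variable r2 : {set 'I_n} -> R.
Hypothesis r2_attained :
  forall S, exists2 u, supported S u & r2 S = 1 - quad_err u.
Hypothesis r2_ge : forall S u, supported S u -> 1 - quad_err u <= r2 S.

Lemma r2_mono S L : S \subset L -> r2 S <= r2 L.
Proof.
have [u Su ->] := r2_attained S => SL.
exact: r2_ge (supported_sub SL Su).
Qed.

Lemma r2_gain_le S L lam : 0 <= lam ->
  (forall w, supported (S :|: L) w -> lam * dotr w w <= qform C w) ->
  lam * (r2 (S :|: L) - r2 L) <= \sum_(i in S) (r2 (i |: L)%SET - r2 L).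
Proof.
move=> lam0 SLq; have [u Lu ru] := normal_equations L.
(* The optimum for [L] is replaced by the solution u of the normal equations, whose residual is
   known to vanish on [L]. *)
have -> : r2 L = 1 - quad_err u.
  have [v Lv eL] := r2_attained L; have := r2_ge Lu; rewrite eL.
  by have := quad_err_min Lu ru Lv; lra.
have [v SLv ->] := r2_attained (S :|: L).
have -> : 1 - quad_err v - (1 - quad_err u) = quad_err u - quad_err v by ring.
apply: le_trans (quad_err_gain_le lam0 Lu ru SLv SLq) _.
apply: ler_sum => i iS.
have : supported (i |: L) (u + (b - u *m C) 0 i *: delta_mx 0 i).
  move=> j; rewrite !inE negb_or => /andP[ji jL].
  by rewrite !mxE Lu// (negbTE ji) mulr0 addr0.
by move=> /r2_ge; rewrite quad_err_coord; lra.
Qed.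

End LeastSquares.
End QuadraticForms.

(** * Integrability of real-valued functions *)

Section RealIntegrals.
Context {d : measure_display} {T : measurableType d} {R : realType}.
Variable mu : {measure set T -> \bar R}.
Implicit Types (f g : T -> R).

Definition Rintegrable f := mu.-integrable setT (EFin \o f).

Lemma RintegrableD f g : Rintegrable f -> Rintegrable g ->
  Rintegrable (fun x => f x + g x).
Proof. by move=> mf mg; exact: (integrableD measurableT mf mg). Qed.

Lemma RintegrableZ a f : Rintegrable f -> Rintegrable (fun x => a * f x).
Proof. by move=> mf; exact: (integrableZl measurableT a mf). Qed.

Lemma Rintegrable_sum (I : Type) (s : seq I) (f : I -> T -> R) :
  (forall i, Rintegrable (f i)) -> Rintegrable (fun x => \sum_(i <- s) f i x).
Proof.
move=> fi; elim: s => [|i s IH].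
  by under eq_fun do rewrite big_nil; exact: integrable0.
by under eq_fun do rewrite big_cons; exact: RintegrableD.
Qed.

Lemma Rintegral_sum (I : Type) (s : seq I) (f : I -> T -> R) :
  (forall i, Rintegrable (f i)) ->
  (\int[mu]_x (\sum_(i <- s) f i x) = \sum_(i <- s) \int[mu]_x f i x)%R.
Proof.
move=> fi; elim: s => [|i s IH].
  rewrite big_nil /Rintegral; under eq_integral do rewrite big_nil.
  by rewrite integral0.
under eq_Rintegral do rewrite big_cons.
rewrite big_cons RintegralD// ?IH//; [exact: fi|exact: Rintegrable_sum].
Qed.

(** Domination by the integrable function f^2 + g^2 >= |f g|. *)
Lemma Rintegrable_mul f g : measurable_fun setT f -> measurable_fun setT g ->
  Rintegrable (fun x => f x * f x) -> Rintegrable (fun x => g x * g x) ->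
  Rintegrable (fun x => f x * g x).
Proof.
move=> mf mg if2 ig2; have := RintegrableD if2 ig2; apply: le_integrable => //.
  by apply/measurable_EFinP; exact: measurable_funM.
move=> x _ /=; rewrite lee_fin normrM -!expr2.
rewrite [leRHS]ger0_norm ?addr_ge0 ?sqr_ge0//.
rewrite -[f x ^+ 2]real_normK ?num_real// -[g x ^+ 2]real_normK ?num_real//.
have := sqr_ge0 (`|f x| - `|g x|); have := sqr_ge0 (`|f x| + `|g x|).
by lra.
Qed.

End RealIntegrals.

(** * Mean squared error as a quadratic function of the coefficients *)

Section SquaredError.
Context {d : measure_display} {T : measurableType d} {R : realType}.
Variables (P : probability T R) (n : nat).
Variables (Z : {RV P >-> R}) (X : 'I_n -> {RV P >-> R}).

Lemma covariance_mean0 (Y W : {RV P >-> R}) :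
  ('E_P[Y] = 0)%E -> ('E_P[W] = 0)%E ->
  covariance P Y W = (\int[P]_x (Y x * W x)%:E)%E.
Proof.
move=> EY EW; rewrite unlock EY EW /= unlock; apply: eq_integral => x _ /=.
by rewrite /GRing.mul /= !subr0.
Qed.

(** Square integrability comes from the variance: Y^2 is nonnegative with integral 1, which is
    finite. *)
Lemma mean0_variance1 (Y : {RV P >-> R}) :
  ('E_P[Y] = 0)%E -> ('V_P[Y] = 1)%E ->
  Rintegrable P (fun x => Y x * Y x) /\ \int[P]_x (Y x * Y x) = 1.
Proof.
move=> EY; rewrite /variance covariance_mean0// => VY; split; last first.
  by rewrite /Rintegral VY.
apply/integrableP; split.
  by apply/measurable_EFinP; exact: measurable_funM.
under eq_integral do rewrite /= ger0_norm -?expr2 ?sqr_ge0// expr2.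
by rewrite VY ltry.
Qed.

Hypotheses (EZ : ('E_P[Z] = 0)%E) (VZ : ('V_P[Z] = 1)%E).
Hypotheses (EX : forall i, ('E_P[X i] = 0)%E).
Hypotheses (VX : forall i, ('V_P[X i] = 1)%E).

Definition cov_row : 'rV[R]_n := \row_i \int[P]_x (Z x * X i x).

Lemma cov_mxE i j : cov_mx X i j = \int[P]_x (X i x * X j x).
Proof. by rewrite mxE covariance_mean0. Qed.

Lemma tr_cov_mx : (cov_mx X)^T = cov_mx X.
Proof.
apply/matrixP => i j; rewrite mxE !cov_mxE.
by apply: eq_Rintegral => x _; rewrite mulrC.
Qed.

Lemma cov_mx_diag i : cov_mx X i i = 1.
Proof. by rewrite cov_mxE (mean0_variance1 (EX i) (VX i)).2. Qed.

Lemma Rintegrable_XX i j : Rintegrable P (fun x => X i x * X j x).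
Proof.
apply: Rintegrable_mul => //.
- by case: (mean0_variance1 (EX i) (VX i)).
- by case: (mean0_variance1 (EX j) (VX j)).
Qed.

Lemma Rintegrable_ZX i : Rintegrable P (fun x => Z x * X i x).
Proof.
apply: Rintegrable_mul => //.
- by case: (mean0_variance1 EZ VZ).
- by case: (mean0_variance1 (EX i) (VX i)).
Qed.

(** The square of the predictor, expanded so that it integrates term by term to the form of
    [cov_mx X]. *)
Let quad (u : 'rV[R]_n) x := \sum_j \sum_i u 0 i * u 0 j * (X i x * X j x).

Lemma Rintegrable_quad u : Rintegrable P (quad u).
Proof.
do 2 apply: Rintegrable_sum => ?; apply: RintegrableZ; exact: Rintegrable_XX.
Qed.

Lemma quadE u x : quad u x = (\sum_i u 0 i * X i x) ^+ 2.
Proof.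
rewrite expr2 mulr_sumr; apply: eq_bigr => j _.
by rewrite mulr_suml; apply: eq_bigr => i _; ring.
Qed.

Lemma Rintegral_quad u : \int[P]_x quad u x = qform (cov_mx X) u.
Proof.
rewrite Rintegral_sum => [|j]; last first.
  by apply: Rintegrable_sum => ?; apply: RintegrableZ; exact: Rintegrable_XX.
apply: eq_bigr => j _; rewrite Rintegral_sum => [|i]; last first.
  by apply: RintegrableZ; exact: Rintegrable_XX.
rewrite mxE mulr_suml; apply: eq_bigr => i _.
rewrite RintegralZl//; last exact: Rintegrable_XX.
by rewrite cov_mxE; ring.
Qed.

Lemma cov_mx_psd u : 0 <= qform (cov_mx X) u.
Proof.
by rewrite -Rintegral_quad; apply: Rintegral_ge0 => x _; rewrite quadE sqr_ge0.
Qed.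

Lemma mean_sq_errorE (S : {set 'I_n}) (a : 'I_n -> R) :
  mean_sq_error Z X S a =
  quad_err (cov_mx X) cov_row (\row_i (if i \in S then a i else 0)).
Proof.
set u := \row_i _.
have [iZ intZ] := mean0_variance1 EZ VZ.
have iZX : Rintegrable P (fun x => \sum_i u 0 i * (Z x * X i x)).
  by apply: Rintegrable_sum => i; apply: RintegrableZ; exact: Rintegrable_ZX.
rewrite /mean_sq_error unlock -/(Rintegral P setT _).
(* Expand the square; the three parts integrate to 1, -2 u.b and u C u^T. *)
transitivity (\int[P]_x (Z x * Z x +
    (-2 * (\sum_i u 0 i * (Z x * X i x)) + quad u x))).
  apply: eq_Rintegral => x _; rewrite big_mkcond /=.
  rewrite (eq_bigr (fun i => u 0 i * X i x)) => [|i _]; last first.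
    by rewrite mxE; case: ifP => //; rewrite mul0r.
  have -> : \sum_i u 0 i * (Z x * X i x) = Z x * \sum_i u 0 i * X i x.
    by rewrite mulr_sumr; apply: eq_bigr => i _; ring.
  by rewrite quadE; ring.
rewrite RintegralD//; last first.
  by apply: RintegrableD; [exact: RintegrableZ|exact: Rintegrable_quad].
rewrite RintegralD//; [|exact: RintegrableZ|exact: Rintegrable_quad].
rewrite RintegralZl// Rintegral_quad intZ /quad_err addrA; congr (_ + _).
rewrite mulNr; congr (_ - _ * _).
rewrite Rintegral_sum => [|i]; last first.
  by apply: RintegrableZ; exact: Rintegrable_ZX.
apply: eq_bigr => i _; rewrite RintegralZl//; last exact: Rintegrable_ZX.
by rewrite [cov_row 0 i]mxE.
Qed.

Hypothesis C_unit : cov_mx X \in unitmx.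

Lemma cov_mx_gt0 u : u != 0 -> 0 < qform (cov_mx X) u.
Proof.
move=> u0; have [e e0 le_q] := psd_unit_coercive tr_cov_mx cov_mx_psd C_unit.
by apply: lt_le_trans (le_q u); rewrite mulr_gt0// dotr_gt0.
Qed.

Lemma supported_row S (u : 'rV[R]_n) : supported S u ->
  \row_i (if i \in S then u 0 i else 0) = u.
Proof. by move=> Su; apply/rowP => i; rewrite mxE; case: ifPn => // /Su. Qed.

(** The normal equations provide a minimiser, so the minimum inside [R2] is a genuine one. *)
Lemma R2P S : exists2 u, supported S u &
  R2 Z X S = 1 - quad_err (cov_mx X) cov_row u /\
  forall v, supported S v -> quad_err (cov_mx X) cov_row u <=
                             quad_err (cov_mx X) cov_row v.
Proof.
have [u Su ru] := normal_equations cov_row cov_mx_gt0 S.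
have le_u := quad_err_min tr_cov_mx cov_mx_gt0 Su ru.
exists u => //; split => //; congr (1 - _); apply: minimumE.
  by exists (fun i => u 0 i) => //; rewrite mean_sq_errorE supported_row.
move=> _ [a _ <-]; rewrite mean_sq_errorE; apply: le_u => i iS.
by rewrite mxE (negbTE iS).
Qed.

Lemma R2_attained S : exists2 u, supported S u &
  R2 Z X S = 1 - quad_err (cov_mx X) cov_row u.
Proof. by have [u Su [eu _]] := R2P S; exists u. Qed.

Lemma R2_ge S u : supported S u ->
  1 - quad_err (cov_mx X) cov_row u <= R2 Z X S.
Proof. by move=> Su; have [v Sv [-> /(_ u Su)]] := R2P S; lra. Qed.

(** Needed where the ratio is 0/0 = 1. For n > 0, test on a basis vector, using C_ii = 1. *)
Lemma sparse_lambda_min_le1 m : (0 < m)%N ->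
  sparse_lambda_min (cov_mx X) m <= 1.
Proof.
move=> m0; case: (posnP n) => [n0|n0].
  (* Without eigenvalues, minimum takes its default value 0. *)
  have /negbTE nm : ~~ (m <= n)%N by rewrite n0 -ltnNge.
  rewrite /sparse_lambda_min nm /lambda_min /minimum.
  rewrite xgetPN ?ler01// => a [/eigenvalueP[v _ /rV0Pn[i]]].
  by exfalso; have := leq_ltn_trans (leq0n i) (ltn_ord i); rewrite n0.
pose i := Ordinal n0.
have := @sparse_lambda_min_le _ _ _ tr_cov_mx m [set i]%SET (delta_mx 0 i) m0.
rewrite cards1 => /(_ m0); rewrite qform_delta cov_mx_diag dotr_delta mxE !eqxx.
rewrite mulr1; apply => j; rewrite inE => ji.
by rewrite mxE (negbTE ji) andbF.
Qed.

End SquaredError.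

Theorem lemma2p4 (d : measure_display) (T : measurableType d) (R : realType)
    (P : probability T R) (n : nat)
    (Z : {RV P >-> R}) (X : 'I_n -> {RV P >-> R})
    (EZ : ('E_P[Z] = 0)%E) (VZ : ('V_P[Z] = 1)%E)
    (EX : forall i, ('E_P[X i] = 0)%E) (VX : forall i, ('V_P[X i] = 1)%E)
    (C_unit : cov_mx X \in unitmx)
    (U : {set 'I_n}) (k : nat) (k_ge1 : (1 <= k)%N) :
  submod_ratio Z X U k >= sparse_lambda_min (cov_mx X) (k + #|U|) /\
  sparse_lambda_min (cov_mx X) (k + #|U|) >= lambda_min (cov_mx X).
Proof.
have sC := tr_cov_mx EX.
have m0 : (0 < k + #|U|)%N by rewrite addn_gt0 k_ge1.
split; last exact: lambda_min_le_sparse.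
set lam := sparse_lambda_min _ _.
have lam_le1 : lam <= 1 by exact: (sparse_lambda_min_le1 EX VX).
have C_gt0 := cov_mx_gt0 EX VX C_unit.
have r2_att := R2_attained EZ VZ EX VX C_unit.
have r2_ge := R2_ge EZ VZ EX VX C_unit.
(* Pairs (L, S) form a finite type, so [minimum_image] yields a pair attaining the ratio. *)
pose A :=
  [set p : {set 'I_n} * {set 'I_n} |
    [/\ p.1 \subset U, (#|p.2| <= k)%N & [disjoint p.2 & p.1]%B]]%classic.
pose rat (p : {set 'I_n} * {set 'I_n}) := ratio01
  (\sum_(i in p.2) (R2 Z X (i |: p.1)%SET - R2 Z X p.1))
  (R2 Z X (p.2 :|: p.1)%SET - R2 Z X p.1).
have A0 : (A !=set0)%classic.
  exists (finset.set0, finset.set0); split => /=.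
  - exact: finset.sub0set.
  - by rewrite cards0.
  - by rewrite -setI_eq0 finset.set0I.
have -> : submod_ratio Z X U k = minimum [set rat p | p in A]%classic.
  congr minimum; apply/seteqP; split => r.
    by move=> [L [S [LU Sk SL ->]]]; exists (L, S).
  by move=> [[L S] [LU Sk SL] <-]; exists L, S.
have [[L S] [/= LU Sk SL] [-> _]] := minimum_image rat A0.
rewrite /rat /ratio01 /=; set N := \sum_(i in S) _; set D := _ - _.
have D0 : 0 <= D by rewrite subr_ge0 (r2_mono r2_att r2_ge)// finset.subsetUr.
have N0 : 0 <= N.
  apply: sumr_ge0 => i _; rewrite subr_ge0 (r2_mono r2_att r2_ge)//.
  exact: finset.subsetUr.
(* In the 0/0 case the ratio is 1 and [lam_le1] suffices. *)
case: ifPn => [//|ND].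
have lamDN : 0 <= lam -> lam * D <= N.
  move=> lam0.
  apply: (r2_gain_le sC C_gt0 (cov_mx_diag EX VX) r2_att r2_ge lam0).
  move=> w; apply: sparse_lambda_min_le => //.
  by rewrite (leq_trans (leq_card_setU _ _))// leq_add// subset_leq_card.
(* If D = 0, monotonicity squeezes each R^2 of [i |: L] between equal values, so N = 0 as well, the
   case already excluded. *)
have [Dz|Dn] := eqVneq D 0.
  case/negP: ND; rewrite Dz eqxx andbT; apply/eqP; apply: big1 => i iS.
  have SiL : i |: L \subset S :|: L by rewrite finset.setSU// finset.sub1set.
  have := r2_mono r2_att r2_ge SiL.
  have := r2_mono r2_att r2_ge (finset.subsetUr [set i]%SET L).
  by move: Dz; rewrite /D; lra.
have Dgt0 : 0 < D by rewrite lt_def Dn.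
(* The gain bound requires lam >= 0; otherwise lam D <= 0 <= N by signs alone. *)
rewrite ler_pdivlMr//; have [lam0|/ltW lam0] := leP 0 lam; first exact: lamDN.
by apply: le_trans N0; rewrite mulr_le0_ge0.
Qed.
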